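(* Let $T_1$ and $T_2$ be operator semigroups on sets $D_1$ and $D_2$, respectively, let $\theta\subseteq T_1\times T_2$, let $U\subseteq D_1$, $V\subseteq D_2$, and let $\phi$ be a $\theta$-morphism from $\langle U\rangle_{T_1}$ to $\langle V\rangle_{T_2}$. If $\operatorname{Dom}\theta=T_1=\langle g\rangle$ for some function $g:D_1\to D_1$, $\operatorname{Im}\theta=T_2$, and $\theta$ is distributive over $V\cup\langle V\rangle_{T_2}$, then there exists a map $\alpha:U\to V\cup\langle V\rangle_{T_2}$ such that $\phi$ is constructible by $\alpha$.
   Context: An operator semigroup on a set $D$ is a set $T$ of functions $D\to D$ closed under composition. $\langle g\rangle$ denotes the smallest operator semigroup on $D_1$ containing $g$, i.e. $\{g^k:k\ge1\}$. For $U\subseteq D$, $\langle U\rangle_T=\{f(u):f\in T,u\in U\}$, and a $T$-space is a subset of $D$ of this form. For a binary relation $\theta\subseteq T_1\times T_2$, $f\in\operatorname{Dom}\theta$ and $a\in D_2$, we say that $\theta(f)(a)$ is well-defined if $g_1(a)=g_2(a)$ for all $(f,g_1),(f,g_2)\in\theta$, and then $\theta(f)(a)$ denotes this common value. Convention: every asserted equation includes the assertion that both sides are well-defined. A map $\phi$ from a $T_1$-space $S$ to a $T_2$-space is a $\theta$-morphism if $\phi(f(a))=\theta(f)(\phi(a))$ for all $f\in\operatorname{Dom}\theta$ and $a\in S$. For $A\subseteq D_2$, $\theta$ is distributive over $A$ if $\theta(f\circ g)(a)=(\theta(f)\circ\theta(g))(a)$, i.e. $\theta(f\circ g)(a)=\theta(f)(\theta(g)(a))$,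 for all $f,g\in\operatorname{Dom}\theta$ and $a\in A$ (in particular $f\circ g\in\operatorname{Dom}\theta$). When $\operatorname{Dom}\theta=T_1$, a $\theta$-morphism $\phi$ from $\langle U\rangle_{T_1}$ is constructible by a map $\alpha:U\to D_2$ if $\phi(f(u))=\theta(f)(\alpha(u))$ for all $u\in U$ and $f\in T_1$. *)

(* Defs.v *)
From mathcomp Require Import all_boot.
From mathcomp Require Import boolp classical_sets.

Set Implicit Arguments.
Unset Strict Implicit.
Unset Printing Implicit Defensive.

Local Open Scope classical_set_scope.

(* Maps between subsets are functions between the coerced subtypes
   [{x | x \in A}], so that no default value is needed outside the domain and
   empty carriers cause no side condition. *)

Definition operator_semigroup (D : Type) (T : set (D -> D)) : Prop :=
  forall f g, T f -> T g -> T (f \o g).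

Definition generated_semigroup (D : Type) (g : D -> D) : set (D -> D) :=
  smallest (@operator_semigroup D) [set g].

Definition span (D : Type) (T : set (D -> D)) (U : set D) : set D :=
  [set f u | f in T & u in U].

Section Theta.
Variables (D1 D2 : Type) (theta : set ((D1 -> D1) * (D2 -> D2))).

Definition Dom : set (D1 -> D1) := fst @` theta.

Definition Im : set (D2 -> D2) := snd @` theta.

Definition well_defined (f : D1 -> D1) (a : D2) : Prop :=
  Dom f /\
  forall g1 g2, theta (f, g1) -> theta (f, g2) -> g1 a = g2 a.

(* [theta_eq f a b] reads: theta(f)(a) is well-defined and equal to b. *)
Definition theta_eq (f : D1 -> D1) (a b : D2) : Prop :=
  well_defined f a /\ exists2 g, theta (f, g) & g a = b.

(* phi(f(a)) = theta(f)(phi(a)); the left-hand side being well-defined means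
   that f(a) is an element b of the domain S. *)
Definition theta_morphism (S : set D1) (S' : set D2) (phi : S -> S') : Prop :=
  forall f, Dom f -> forall a : S,
    exists2 b : S, \val b = f (\val a)
                 & theta_eq f (\val (phi a)) (\val (phi b)).

(* theta(f o g)(a) = theta(f)(theta(g)(a)), with b = theta(g)(a) and c the
   common value of both sides. *)
Definition distributive_over (A : set D2) : Prop :=
  forall f g, Dom f -> Dom g -> forall a, A a ->
    exists b c, [/\ theta_eq g a b, theta_eq f b c & theta_eq (f \o g) a c].

Definition constructible_by (T1 : set (D1 -> D1)) (U : set D1) (S' : set D2)
    (phi : span T1 U -> S') (alpha : U -> D2) : Prop :=
  forall (u : U) f, T1 f ->
    exists2 b : span T1 U, \val b = f (\val u)
                         & theta_eq f (alpha u) (\val (phi b)).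

End Theta.

(* Main.v *)
Require Import Defs.
From mathcomp Require Import all_boot.
From mathcomp Require Import boolp classical_sets.

(** The value of a constructing map at [u] only has to be a preimage of
    [phi (g u)] under [theta g]. Indeed every member of the semigroup generated
    by [g] other than [g] itself has the form [h \o g], and distributivity
    followed by the morphism property gives
      theta(h o g)(a) = theta(h)(theta(g)(a)) = theta(h)(phi(g u))
                      = phi(h(g u)).
    Such a preimage exists in [V `|` span T2 V]: since [T2] is the image of
    [theta], the point [phi (g u)] is theta(f)(v) for some [v] in [V] and some
    power [f] of [g]. If [f] is [g], then [v] is a preimage; otherwise [f] is
    [g \o h] and, by distributivity, theta(h)(v) is one
    ([theta_generator_preimage]). The map is then obtained by choice. *)

Local Open Scope classical_set_scope.

Lemma generated_semigroup_gen (D : Type) (g : D -> D) :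
  generated_semigroup g g.
Proof. by move=> T [_]; exact. Qed.

Lemma generated_semigroup_comp (D : Type) (g : D -> D) :
  operator_semigroup (generated_semigroup g).
Proof.
move=> f h Tf Th T TP; case: (TP) => Tcomp _.
by apply: Tcomp; [exact: Tf | exact: Th].
Qed.

(** Both factorizations are needed: [g] is split off on the left to find a
    preimage under [theta g], and on the right to reduce to the morphism
    property at [g u]. Working with factorizations rather than with iterates
    keeps all the equations between functions true by computation. *)
Lemma generated_semigroup_factor {D : Type} {g f : D -> D} :
  generated_semigroup g f ->
  f = g \/
  (exists2 h, generated_semigroup g h & f = g \o h) /\
  (exists2 h, generated_semigroup g h & f = h \o g).
Proof.
set T := generated_semigroup g => Tf.
pose P := [set f | T f /\ (f = g \/
  (exists2 h, T h & f = g \o h) /\ (exists2 h, T h & f = h \o g))].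
suff [] : P f by [].
apply: Tf; split; last first.
  by move=> _ ->; split; [exact: generated_semigroup_gen | left].
move=> f1 f2 [Tf1 f1P] [Tf2 f2P].
split; first exact: generated_semigroup_comp.
right; split.
- case: f1P => [-> | [[h Th ->] _]]; first by exists f2.
  by exists (h \o f2) => //; exact: generated_semigroup_comp.
- case: f2P => [-> | [_ [h Th ->]]]; first by exists f1.
  by exists (f1 \o h) => //; exact: generated_semigroup_comp.
Qed.

Section Theta.
Context {D1 D2 : Type} {theta : set ((D1 -> D1) * (D2 -> D2))}.

Lemma theta_eq_val {f : D1 -> D1} {h : D2 -> D2} {a b : D2} :
  theta (f, h) -> theta_eq theta f a b -> h a = b.
Proof. by move=> fh [[_ fP] [h' fh' <-]]; exact: fP. Qed.

Lemma theta_eq_inj {f : D1 -> D1} {a b c : D2} :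
  theta_eq theta f a b -> theta_eq theta f a c -> b = c.
Proof. by move=> [_ [h fh <-]]; exact: theta_eq_val. Qed.

Lemma theta_eq_span {f : D1 -> D1} {V : set D2} {a b : D2} :
  V a -> theta_eq theta f a b -> span (Im theta) V b.
Proof.
by move=> Va [_ [h fh <-]]; exists h; [exists (f, h) | exists a].
Qed.

(** Distributivity is used first with [f] on the inside, merely to know that
    theta(f)(v) is well-defined, so that the operator of [Im theta] producing
    [w] from [v] may be traded for [f]. *)
Lemma theta_generator_preimage {g : D1 -> D1} {V : set D2} {w : D2} :
  Dom theta = generated_semigroup g -> distributive_over theta V ->
  span (Im theta) V w ->
  exists2 a, (V `|` span (Im theta) V) a & theta_eq theta g a w.
Proof.
move=> DomE thetaD [h0 [[f h] /= fh <-] [v Vv <-]] {h0}.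
have Domf : Dom theta f by exists (f, h).
have fv : theta_eq theta f v (h v).
  have [b [_ [fb _ _]]] := thetaD f f Domf Domf v Vv.
  by rewrite (theta_eq_val fh fb).
have := Domf; rewrite DomE => /generated_semigroup_factor[fg | [[k Tk fgk] _]].
  by exists v; [left | rewrite -fg].
have Domg : Dom theta g by rewrite DomE; exact: generated_semigroup_gen.
have Domk : Dom theta k by rewrite DomE.
have [b [c [kb gc gkc]]] := thetaD g k Domg Domk v Vv.
exists b; first by right; exact: theta_eq_span kb.
by rewrite -fgk in gkc; rewrite (theta_eq_inj fv gkc).
Qed.

End Theta.

Theorem theorem7p3p9 (D1 D2 : Type)
    (T1 : set (D1 -> D1)) (T2 : set (D2 -> D2))
    (hT1 : operator_semigroup T1) (hT2 : operator_semigroup T2)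
    (theta : set ((D1 -> D1) * (D2 -> D2))) (htheta : theta `<=` T1 `*` T2)
    (U : set D1) (V : set D2)
    (phi : span T1 U -> span T2 V) (hphi : theta_morphism theta phi)
    (g : D1 -> D1)
    (hDom : Dom theta = T1) (hT1g : T1 = generated_semigroup g)
    (hIm : Im theta = T2)
    (hdistr : distributive_over theta (V `|` span T2 V)) :
  exists alpha : U -> V `|` span T2 V,
    constructible_by theta phi (fun u => \val (alpha u)).
Proof.
have DomE : Dom theta = generated_semigroup g by rewrite hDom.
have T1g : T1 g by rewrite hT1g; exact: generated_semigroup_gen.
have distrV : distributive_over theta V.
  by move=> f h Domf Domh a Va; apply: hdistr => //; left.
have preimage (u : U) : exists a : V `|` span T2 V,
    exists2 gu : span T1 U, \val gu = g (\val u)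
                          & theta_eq theta g (\val a) (\val (phi gu)).
  have guP : span T1 U (g (\val u)).
    by exists g => //; exists (\val u) => //; exact: set_valP.
  pose gu : span T1 U := SigSub (mem_set guP).
  have : span (Im theta) V (\val (phi gu)) by rewrite hIm; exact: set_valP.
  move=> /(theta_generator_preimage DomE distrV); rewrite hIm => -[a Va ga].
  by exists (SigSub (mem_set Va)); exists gu.
have [alpha alphaP] := choice preimage.
exists alpha => u f.
have [gu guE ga] := alphaP u.
rewrite {1}hT1g => /generated_semigroup_factor[-> | [_ [h Th ->]]].
  by exists gu.
have Domh : Dom theta h by rewrite DomE.
have Domg : Dom theta g by rewrite hDom.
have [b bE hb] := hphi h Domh gu.
exists b; first by rewrite bE guE.
have [d [c [gd hc hgc]]] := hdistr h g Domh Domg _ (set_valP (alpha u)).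
rewrite -(theta_eq_inj ga gd) in hc.
by rewrite (theta_eq_inj hb hc).
Qed.
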